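(* Let $G$ be a finite group of order $n$ and let $k$ be an integer with $1\le k\le n-1$. Let $S$ be a uniformly random $k$-element subset of $G\setminus\{1\}$. Then $$\Pr\big(\operatorname{diam}(\operatorname{Cay}(G,S))>2\big)\le (n-1)\,p\big(n,k,\lfloor (n-4)/12\rfloor\big).$$
   Context: For a finite group $G$ and a subset $S\subseteq G\setminus\{1\}$, the Cayley digraph $\operatorname{Cay}(G,S)$ has vertex set $G$ and arc set $\{(g,gs): g\in G, s\in S\}$. The distance from $g$ to $h$ is the length of the shortest directed path from $g$ to $h$ (infinite if there is none). The diameter $\operatorname{diam}(\operatorname{Cay}(G,S))$ is the smallest integer $d$ such that for every ordered pair $(g,h)$ the distance from $g$ to $h$ is at most $d$ (and is $\infty$ if no such $d$ exists; then it counts as $>2$). The function $p$ is defined by $$p(n,k,t)=\sum_{i=0}^{t}(-1)^i\binom{t}{i}\frac{(k)_{2i}}{(n-1)_{2i}},$$ where $(r)_\ell=r(r-1)\cdots(r-\ell+1)$ is the descending factorial with $(r)_0=1$; an empty sum (when $t<0$) equals $0$. *)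

(* Defs.v *)
From HB Require Import structures.
From mathcomp Require Import all_boot all_order all_algebra all_fingroup.
From mathcomp Require Import boolp.

Set Implicit Arguments.
Unset Strict Implicit.
Unset Printing Implicit Defensive.

Import Order.TTheory GRing.Theory Num.Theory.

Local Open Scope ring_scope.

(* Elements of nat + {oo} are represented in option nat, with None for oo. *)
Definition enat_le (x : option nat) (d : nat) : bool :=
  if x is Some m then (m <= d)%N else false.

(* None if no natural number satisfies P. *)
Definition least (P : pred nat) : option nat :=
  if pselect (exists d, P d) is left exP then Some (ex_minn exP) else None.

Section Digraph.
Variables (T : finType) (e : rel T).

Definition dipath (x y : T) (d : nat) : bool :=
  [exists p : d.-tuple T, path e x p && (last x p == y)].

Definition dist (x y : T) : option nat := least (dipath x y).

Definition diam : option nat :=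
  least (fun d => [forall x, forall y, enat_le (dist x y) d]).

End Digraph.

Definition Cay (gT : finGroupType) (S : {set gT}) : rel gT :=
  fun g h => [exists s in S, h == (g * s)%g].

Definition nontrivial_ksubsets (gT : finGroupType) (k : nat) : {set {set gT}} :=
  [set S : {set gT} | (S \subset [set: gT] :\ 1%g) && (#|S| == k)].

(* Probability of E under the uniform distribution on A; all the
   probabilities involved are rational. *)
Definition uniform_Pr (T : finType) (A E : {set T}) : rat :=
  #|A :&: E|%:R / #|A|%:R.

(* t ranges over int because (n - 4) / 12 has a negative floor for n < 4;
   a negative t gives the empty sum. *)
Definition p (n k : nat) (t : int) : rat :=
  if t is Posz m then
    \sum_(0 <= i < m.+1) (-1) ^+ i * 'C(m, i)%:R
       * ((k ^_ (2 * i))%:R / ((n - 1) ^_ (2 * i))%:R)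
  else 0.

(* Main.v *)
(* By vertex-transitivity, diam > 2 forces some g <> 1 to lie outside S S.  For
   fixed g, f x = x^-1 g permutes G \ {1, g}, and g lies in S S as soon as S
   contains some pair {x, f x}.  Fixed points of f are square roots of g, of
   which there are at most 3n/4; away from them the arcs x -> f x form a
   digraph with in- and outdegree 1, in which a pair {x, f x} meets at most three
   arcs, so a maximal matching contains at least t = floor((n-4)/12) pairs.  By
   inclusion-exclusion, a random S contains none of t given disjoint pairs with
   probability p(n,k,t), and a union bound over g concludes.  For n < 4, where
   the right-hand side is 0, the diameter never exceeds 2. *)

Require Import Defs.
From HB Require Import structures.
From mathcomp Require Import all_boot all_order all_algebra all_fingroup.
From mathcomp Require Import boolp.
From mathcomp Require Import zify.

Set Implicit Arguments.
Unset Strict Implicit.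
Unset Printing Implicit Defensive.

Import Order.TTheory GRing.Theory Num.Theory.

Local Open Scope ring_scope.

(** * Subsets avoiding disjoint pairs *)

Lemma bin_mul_ffact (n k b : nat) : (b <= k)%N -> (k <= n)%N ->
  ('C(n, k) * k ^_ b = 'C(n - b, k - b) * n ^_ b)%N.
Proof.
move=> le_bk le_kn; have le_bn := leq_trans le_bk le_kn.
have := @bin_fact (n - b) (k - b) (leq_sub2r b le_kn).
rewrite subnBA // subnK // => E.
(* Multiplied by (k - b)! (n - k)!, both sides become n!. *)
apply/eqP; rewrite -(eqn_pmul2r (fact_gt0 (k - b))) -(eqn_pmul2r (fact_gt0 (n - k))).
rewrite -(mulnA 'C(n, k)) ffact_fact // -mulnA bin_fact //.
by rewrite -(ffact_fact le_bn) -E; apply/eqP; lia.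
Qed.

(** Removing [B] matches these sets with the subsets of [U :\: B] of size [k - #|B|]. In the
    cross-multiplied form the case [#|B| > k] is covered too, as both sides vanish. *)
Lemma card_supersets (T : finType) (U B : {set T}) (k : nat) :
    B \subset U -> (k <= #|U|)%N ->
  (#|[set S : {set T} | (S \subset U) && (#|S| == k) & B \subset S]|
     * #|U| ^_ #|B| = 'C(#|U|, k) * k ^_ #|B|)%N.
Proof.
move=> sBU le_kU; have [le_Bk | lt_kB] := leqP #|B| k; last first.
  rewrite (ffact_small lt_kB) muln0; apply/eqP; rewrite muln_eq0 cards_eq0.
  apply/orP; left; apply/eqP/setP=> S; rewrite !inE.
  apply/negP=> /andP[/andP[_ /eqP cS] /subset_leq_card]; lia.
rewrite bin_mul_ffact //; congr (_ * _)%N.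
rewrite -(cardsDS sBU) -(cards_draws (U :\: B)).
set A := [set S | _]; rewrite -(@card_in_imset _ _ (fun S => S :\: B) A) => [|S S'].
  apply: eq_card => S; rewrite !inE.
  apply/imsetP/andP=> [[S' /[!inE] /andP[/andP[sS /eqP cS] sB] ->] | [sS /eqP cS]].
    by rewrite setSD // cardsDS // cS.
  move: sS; rewrite subsetD => /andP[sSU dSB]; exists (S :|: B).
    rewrite inE subUset sSU sBU subsetUr cardsU cS andbT /=.
    by rewrite (disjoint_setI0 dSB) cards0 subn0 subnK.
  by rewrite setDUl setDv setU0; apply/esym/setDidPl.
rewrite !inE => /andP[_ sB] /andP[_ sB'] E.
by rewrite -(setID S B) -(setID S' B) E (setIidPr sB) (setIidPr sB').
Qed.

Lemma sum_by_card (I : finType) (R : nmodType) (F : nat -> R) :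
  \sum_(J : {set I}) F #|J| = \sum_(0 <= i < #|I|.+1) F i *+ 'C(#|I|, i).
Proof.
rewrite big_mkord.
rewrite (partition_big (fun J : {set I} => inord #|J| : 'I_#|I|.+1) predT) //=.
apply: eq_bigr => i _; have E (J : {set I}) : (inord #|J| == i :> 'I_#|I|.+1) = (#|J| == i).
  by rewrite -val_eqE /= inordK // ltnS max_card.
under eq_bigl do rewrite E.
rewrite -card_draws -sum1dep_card -sumrMnr /=; apply: eq_bigr => J /eqP ->.
by rewrite mulr1n.
Qed.

Lemma natr_forall (R : pzSemiRingType) (I : finType) (P : pred I) (A : {pred I}) :
  \prod_(i in A) (P i)%:R = [forall i in A, P i]%:R :> R.
Proof.
case: forall_inP => [AP | nAP]; first by rewrite big1 // => i /AP ->.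
have [i Ai nPi] : exists2 i, i \in A & ~~ P i.
  by apply/exists_inP; rewrite -negb_forall_in; apply/forall_inP.
have -> : \prod_(i in A) (P i)%:R = (\prod_(i in A) P i)%:R :> R.
  rewrite (big_morph (fun n => n%:R : R) (@natrM R) (erefl _)) //.
by rewrite (bigD1 i) //= (negbTE nPi) mul0n.
Qed.

(** Inclusion-exclusion: the indicator of avoidance is the product of 1 - [[P i] in [S]], expanded
    over sets [J] of indices. By disjointness the pairs in [J] cover [2 * #|J|] points, so each term
    depends on [#|J|] alone. *)
Lemma card_avoiding_pairs (T I : finType) (U : {set T}) (P : I -> {set T})
    (k : nat) :
    (k <= #|U|)%N -> (forall i, P i \subset U) -> (forall i, #|P i| = 2) ->
    (forall i j, i != j -> [disjoint P i & P j]) ->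
  #|[set S : {set T} | (S \subset U) && (#|S| == k)
                     & [forall i, ~~ (P i \subset S)]]|%:R
  = 'C(#|U|, k)%:R * \sum_(0 <= i < #|I|.+1) (-1) ^+ i * 'C(#|I|, i)%:R
       * ((k ^_ (2 * i))%:R / (#|U| ^_ (2 * i))%:R) :> rat.
Proof.
move=> le_kU sPU cP tP.
pose h i : rat := 'C(#|U|, k)%:R * ((-1) ^+ i * ((k ^_ (2 * i))%:R / (#|U| ^_ (2 * i))%:R)).
transitivity (\sum_(J : {set I}) h #|J|); last first.
  rewrite sum_by_card mulr_sumr; apply: eq_bigr => i _.
  by rewrite /h -mulrnAr -mulrnAl mulr_natr.
pose Q (S : {set T}) := (S \subset U) && (#|S| == k).
have cB (J : {set I}) : #|\bigcup_(i in J) P i| = (2 * #|J|)%N.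
  rewrite [\bigcup_(i in J) _]big_mkcond /= -sum1_card partition_disjoint_bigcup.
    rewrite (eq_bigr (fun i => if i \in J then 2 else 0)) => [|i _].
      by rewrite -big_mkcond sum_nat_const mulnC.
    by rewrite sum1_card; case: ifP; rewrite ?cards0 ?cP.
  move=> i j /tP; case: ifP => _; case: ifP => _ //; rewrite -!setI_eq0 ?setI0 ?set0I //.
transitivity (\sum_(S : {set T} | Q S) \sum_(J : {set I})
                (-1) ^+ #|J| * (\bigcup_(i in J) P i \subset S)%:R : rat).
  rewrite -sum1_card natr_sum big_mkcond [RHS]big_mkcond; apply: eq_bigr => S _.
  rewrite inE -/(Q S); case: (Q S) => //=.
  transitivity (\prod_i (- (P i \subset S)%:R + 1) : rat).
    transitivity ([forall i in predT, ~~ (P i \subset S)]%:R : rat).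
      by case: ifP => /=.
    rewrite -natr_forall; apply: eq_bigr => i _.
    by case: (P i \subset S); rewrite ?addNr ?oppr0 ?add0r.
  rewrite bigA_distr; apply: eq_bigr => J _.
  rewrite -big_mkcond /= prodrN natr_forall; congr (_ * _%:R).
  by congr nat_of_bool; apply/forall_inP/bigcupsP.
rewrite exchange_big /=; apply: eq_bigr => J _.
rewrite -mulr_sumr /h mulrCA; congr (_ * _).
rewrite -cB -natr_sum -big_mkcondr /= sum1dep_card.
have sBU : \bigcup_(i in J) P i \subset U by apply/bigcupsP.
rewrite mulrA -natrM -(card_supersets sBU le_kU) natrM mulfK //.
by rewrite pnatr_eq0 -lt0n ffact_gt0 subset_leq_card.
Qed.

(** * Matchings and square roots *)

Lemma disjoint_images (T : finType) (f : T -> T) (D : {set T}) :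
    injective f -> {in D, forall x, f x != x} ->
  exists2 M : {set T}, M \subset D /\ [disjoint M & f @: M]
                     & (#|D| <= 3 * #|M|)%N.
Proof.
move=> injf fixf.
pose P (M : {set T}) := (M \subset D) && [disjoint M & f @: M].
have [|M /maxsetP[/andP[sMD dM] maxM]] := @ex_maxset _ P.
  by exists set0; rewrite /P sub0set -setI_eq0 set0I eqxx.
(* A point of [D] outside these three sets could be added to the maximal [M]; by injectivity each of
   them has at most [#|M|] elements. *)
exists M => //; suff sD : D \subset M :|: f @: M :|: f @^-1: M.
  apply: leq_trans (subset_leq_card sD) _.
  have := card_imset M injf; have [+ _] := leq_card_setU M (f @: M).
  have [+ _] := leq_card_setU (M :|: f @: M) (f @^-1: M).
  rewrite card_preimset //; lia.
apply/subsetP=> y Dy; rewrite !inE; apply: contraT.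
rewrite !negb_or -andbA => /and3P[My fMy fyM].
suff /maxM E : P (y |: M) by rewrite -(E (subsetUr _ _)) setU11 in My.
rewrite /P subUset sub1set Dy sMD /= imsetU1 -setI_eq0.
rewrite setIUl !setIUr !setU_eq0 !setI_eq0 dM !disjoints1 !inE /=.
by rewrite eq_sym fixf // fMy disjoint_sym disjoints1 fyM.
Qed.

Lemma card_square_roots (gT : finGroupType) (g : gT) :
  g != 1%g -> (4 * #|[set x : gT | (x * x == g)%g]| <= 3 * #|gT|)%N.
Proof.
move=> g1; set A := [set x | _]; rewrite leqNgt; apply/negP=> ltA.
have [a Aa] : exists a, a \in A.
  by apply/set0Pn; rewrite -card_gt0; lia.
pose B := [set x in A | (x * a)%g \in A].
(* [A] and its translate each fill more than three quarters of the group, so they share more than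
   half of it. *)
have cB : (#|gT| < 2 * #|B|)%N.
  have -> : B = A :&: (A :* a^-1)%g.
    by apply/setP=> x; rewrite !inE mem_rcoset invgK inE.
  have := cardsUI A (A :* a^-1)%g; rewrite card_rcoset.
  move: ltA (max_card (A :|: (A :* a^-1)%g)).
  by move: #|_ :|: _| #|_ :&: _| #|A| #|gT|; lia.
(* For x in B, x x = g = x a x a gives a x a = x, i.e. x a = a^-1 x; hence B lies
   in a coset of C(a), which is therefore the whole group, and g = a a = 1. *)
have axa x : x \in B -> (a * x * a = x)%g.
  rewrite !inE => /andP[/eqP xx /eqP xaxa]; apply: (mulgI x).
  by rewrite !mulgA in xaxa *; rewrite xaxa xx.
have [x0 Bx0] : exists x, x \in B by apply/set0Pn; rewrite -card_gt0; lia.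
have sBC : (x0^-1 *: B)%g \subset 'C[a]%g.
  apply/subsetP=> y /lcosetP[x Bx ->]; apply/cent1P.
  have aE z : z \in B -> (z * a = a^-1 * z)%g.
    by move=> /axa E; rewrite -{2}E !mulgA mulVg mul1g.
  have aV z : z \in B -> (z * a^-1 = a * z)%g.
    by move=> /axa E; rewrite -{1}E !mulgK.
  by rewrite /commute -mulgA aE // !mulgA -[in RHS](invgK a) -invMg -aV // invMg invgK.
(* By Lagrange's theorem a subgroup with more than half of the elements has index 1. *)
have CT : 'C[a]%g = [set: gT].
  apply/eqP; rewrite eqEcard subsetT cardsT.
  have := subset_leq_card sBC; rewrite card_lcoset.
  have /cardSg := subsetT 'C[a]%G; rewrite cardsT => /dvdnP[q].
  move: cB; rewrite /=; move: #|gT| #|B| #|'C[a]%g|; case: q => [|[|q]]; nia.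
have xa : (x0 * a = a * x0)%g by apply/cent1P; rewrite CT inE.
have /eqP := axa x0 Bx0; rewrite -xa -mulgA -{2}(mulg1 x0) (inj_eq (mulgI x0)).
by move: Aa; rewrite inE => /eqP ->; rewrite (negbTE g1).
Qed.

(** * From products in the group to the diameter *)

Lemma least_le (P : pred nat) (d e : nat) :
  P d -> (d <= e)%N -> enat_le (least P) e.
Proof.
move=> Pd le_de; rewrite /least; case: pselect => [exP | []]; last by exists d.
by case: ex_minnP => m _ /(_ d Pd) le_md; apply: leq_trans le_md le_de.
Qed.

Lemma diam_Cay_le2 (gT : finGroupType) (S : {set gT}) :
    (forall g, g != 1%g -> (g \in S) || (g \in (S * S)%g)) ->
  enat_le (diam (Cay S)) 2.
Proof.
move=> covS; apply: (@least_le _ 2) => //; apply/forallP=> x; apply/forallP=> y.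
have arc z s : s \in S -> Cay S z (z * s)%g.
  by move=> Ss; apply/exists_inP; exists s.
have [-> | neq_xy] := eqVneq x y.
  apply: (@least_le _ 0) => //; apply/existsP; exists [tuple]; exact: eqxx.
have /covS /orP[Sg | /mulsgP[s t Ss St Eg]] : (x^-1 * y)%g != 1%g.
- by rewrite -(inj_eq (mulgI x)) mulKVg mulg1 eq_sym.
- apply: (@least_le _ 1) => //; apply/existsP; exists [tuple y] => /=.
  by rewrite eqxx -{1}(mulKVg x y) arc.
apply: (@least_le _ 2) => //; apply/existsP; exists [tuple (x * s)%g; y] => /=.
by rewrite eqxx arc // -(mulKVg x y) Eg mulgA arc.
Qed.

(** * Disjoint factorizations of a fixed element *)

Lemma disjoint_factorizations (gT : finGroupType) (g : gT) (t : nat) :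
    g != 1%g -> (12 * t + 4 <= #|gT|)%N ->
  exists2 M : {set gT}, #|M| = t
    & [/\ {in M, forall x, x != 1%g /\ x != g}
        & [disjoint M & [set (x^-1 * g)%g | x in M]]].
Proof.
move=> g1 le_t; pose f (x : gT) := (x^-1 * g)%g.
have injf : injective f by move=> x y /mulIg /invg_inj.
(* [A] is the set of fixed points of [f]; leaving out [1] and [g] keeps both [x] and [f x] different
   from [1]. *)
pose A := [set x : gT | (x * x == g)%g]; pose D := ~: (A :|: [set 1%g; g]).
have [|M [sMD dM] leDM] := @disjoint_images _ f D injf.
  move=> x; rewrite !inE negb_or => /andP[xx _]; apply: contra xx => /eqP E.
  by rewrite -{2}E mulKVg.
(* [D] has at least [#|gT|]/4 - 2 >= 3t - 1 elements, so 3 [#|M|] >= 3t - 1, and integrality gives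
   the bound. *)
have le_tM : (t <= #|M|)%N.
  have := card_square_roots g1; rewrite -/A.
  have := cardsC (A :|: [set 1%g; g]); rewrite -/D.
  have [+ _] := leq_card_setU A [set 1%g; g]; rewrite cards2.
  move: le_t leDM; move: #|A :|: _| #|A| #|D| #|M| #|gT|.
  by case: (_ != _) => /=; lia.
have /card_geqP[s [us <- sM]] := le_tM; exists [set x in s].
  by rewrite cardsE; apply/card_uniqP.
have sSM : [set x in s] \subset M by apply/subsetP=> x /[!inE] /sM.
split=> [x /[!inE] /sM /(subsetP sMD) | ].
  by rewrite !inE !negb_or => /and3P[].
exact: disjointW sSM (imsetS f sSM) dM.
Qed.

Lemma card_ksubsets_not_product_le (gT : finGroupType) (g : gT) (k t : nat) :
    g != 1%g -> (12 * t + 4 <= #|gT|)%N -> (k <= #|gT| - 1)%N ->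
  #|[set S in nontrivial_ksubsets gT k | g \notin (S * S)%g]|%:R
  <= 'C(#|gT| - 1, k)%:R * p #|gT| k t.
Proof.
move=> g1 le_t le_k; have [M cM [M1g dM]] := disjoint_factorizations g1 le_t.
pose I := {x : gT | x \in M}; have cI : #|{: I}| = t by rewrite card_sig -cM.
pose U := [set: gT] :\ 1%g; have cU : #|U| = (#|gT| - 1)%N.
  by rewrite cardsDS ?subsetT // cardsT cards1.
pose P (i : I) := [set val i; (val i)^-1 * g]%g.
(* For [x = y] this makes each [P i] a genuine pair; for [x != y] it gives, with injectivity of
   inversion, disjoint pairs. *)
have neqM x y : x \in M -> y \in M -> x != (y^-1 * g)%g.
  move=> Mx My; apply: contraTneq dM => E; apply/pred0Pn; exists x.
  by rewrite /= Mx; apply/imsetP; exists y.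
rewrite /p -cI -cU; rewrite -(@card_avoiding_pairs _ _ U P); first last.
- move=> i j; rewrite -val_eqE => neq_ij; rewrite -setI_eq0.
  apply/eqP/setP=> x; rewrite !inE; apply/negP=> /andP[/orP[]/eqP-> /orP[]/eqP].
  + by apply/eqP.
  + by apply/eqP/neqM/valP/valP.
  + by apply/nesym/eqP/neqM/valP/valP.
  + by move/mulIg/invg_inj; apply/eqP.
- by move=> i; rewrite cards2 neqM //; apply: valP.
- move=> i; have [x1 xg] := M1g _ (svalP i).
  apply/subsetP=> x; rewrite !inE andbT => /orP[] /eqP -> //.
  by rewrite -(inj_eq (mulgI (val i))) mulKVg mulg1 eq_sym.
- by rewrite cU.
rewrite ler_nat; apply/subset_leq_card/subsetP=> S; rewrite !inE => /andP[-> /=].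
apply: contraR; rewrite negb_forall => /existsP[i]; rewrite negbK subUset !sub1set.
by case/andP=> Si Sfi; apply/mulsgP; exists (val i) ((val i)^-1 * g)%g; rewrite ?mulKVg.
Qed.

(** An element [g != 1] outside both [S] and [S * S] yields, with any [x] in [S], four distinct
    elements: [1], [x], [g] and a fourth, which is [x * g] if [x * x = 1] and [x * x] otherwise. *)
Lemma diam_Cay_small (gT : finGroupType) (S : {set gT}) :
    (#|gT| < 4)%N -> S \subset [set: gT] :\ 1%g -> S != set0 ->
  enat_le (diam (Cay S)) 2.
Proof.
move=> lt4 sS /set0Pn[x Sx]; apply: diam_Cay_le2 => g g1.
have x1 : x != 1%g by have := subsetP sS x Sx; rewrite !inE andbT.
apply: contraLR lt4; rewrite negb_or -leqNgt => /andP[Sg SSg].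
have xg : x != g by apply: contraNneq Sg => <-.
have xxg : (x * x)%g != g by apply: contraNneq SSg => <-; apply: mem_mulg.
have xx_x : (x * x)%g != x by rewrite -{3}(mulg1 x) (inj_eq (mulgI x)).
have [xx1 | xx1] := eqVneq (x * x)%g 1%g.
  have uniq4 : uniq [:: 1; x; g; x * g]%g.
    rewrite /= !inE !negb_or (eq_sym 1%g x) (eq_sym 1%g g) x1 g1 xg /= andbT.
    rewrite -{1}xx1 (inj_eq (mulgI x)) xg -{1}(mulg1 x) (inj_eq (mulgI x)).
    by rewrite (eq_sym 1%g) g1 -{1}(mul1g g) (inj_eq (mulIg g)) eq_sym x1.
  by rewrite -[4%N]/(size [:: 1; x; g; x * g]%g) -(card_uniqP uniq4) max_card.
have uniq4 : uniq [:: 1; x; g; x * x]%g.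
  rewrite /= !inE !negb_or (eq_sym 1%g x) (eq_sym 1%g g) (eq_sym 1%g (x * x)%g).
  by rewrite x1 g1 xx1 xg (eq_sym x) xx_x eq_sym xxg.
by rewrite -[4%N]/(size [:: 1; x; g; x * x]%g) -(card_uniqP uniq4) max_card.
Qed.

(** * The union bound *)

Theorem theorem3p3 (gT : finGroupType) (n k : nat) (order_n : #|gT| = n)
    (k_range : (1 <= k <= n - 1)%N) :
  uniform_Pr (nontrivial_ksubsets gT k)
             [set S : {set gT} | ~~ enat_le (diam (Cay S)) 2]
  <= (n - 1)%N%:R * p n k ((n%:Z - 4) %/ 12)%Z.
Proof.
case/andP: k_range => k_gt0 le_k; set A := nontrivial_ksubsets gT k.
rewrite /uniform_Pr; set E := [set S | _].
have cU : #|[set: gT] :\ 1%g| = (n - 1)%N.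
  by rewrite cardsDS ?subsetT // cardsT cards1 order_n.
have cA : #|A| = 'C(n - 1, k) by rewrite cards_draws cU.
have [lt_n4 | le_4n] := ltnP n 4.
  have -> : A :&: E = set0.
    apply/setP=> S; rewrite !inE; apply/negP=> /andP[/andP[sS /eqP cS]].
    by rewrite diam_Cay_small ?order_n // -card_gt0 cS.
  (* Division rounds down, so the quotient is -1 and [p] is the empty sum. *)
  have -> : ((n%:Z - 4) %/ 12)%Z = Negz 0 by lia.
  by rewrite cards0 mul0r mulr0.
pose t := ((n - 4) %/ 12)%N.
have -> : ((n%:Z - 4) %/ 12)%Z = t by rewrite /t; lia.
have le_t : (12 * t + 4 <= n)%N by rewrite /t; lia.
rewrite ler_pdivrMr ?cA ?ltr0n ?bin_gt0 // -mulrA [p _ _ _ * _]mulrC.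
pose F g := [set S in A | g \notin (S * S)%g].
(* If [S * S] contains every [g != 1], all distances are at most 2. *)
have sAF : A :&: E \subset \bigcup_(g in [set: gT] :\ 1%g) F g.
  apply/subsetP=> S; rewrite in_setI => /andP[AS]; rewrite inE; apply: contraR => nF.
  apply: diam_Cay_le2 => g g1; apply/orP; right; apply: contraR nF => SSg.
  by apply/bigcupP; exists g; [rewrite !inE g1 | rewrite inE AS].
apply: (@le_trans _ _ (\sum_(g in [set: gT] :\ 1%g) #|F g|%:R)).
  rewrite -natr_sum ler_nat; apply: leq_trans (subset_leq_card sAF) _.
  apply: (big_ind2 (fun (B : {set {set gT}}) m => #|B| <= m)%N) => [|B m C m' le_m le_m'|//].
    by rewrite cards0.
  by apply: leq_trans (leq_add le_m le_m'); apply: (leq_card_setU B C).1.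
rewrite mulr_natl -[X in _ *+ X]cU -sumr_const.
apply: ler_sum => g; rewrite !inE andbT -order_n => g1.
by apply: card_ksubsets_not_product_le; rewrite ?order_n.
Qed.
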